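(* Let $n\ge 1$ and work in type $A_n$ with straight orientation. Let $\tilde B^{(0)}=[B^{(0)}\,|\,C^{(0)}]$ be an extended exchange matrix reachable from the framed quiver $[B_0\,|\,I_n]$, and suppose its $c$-matrix $C^{(0)}$ has associated permutation $\sigma\in S_n$. Let $\mathbf v=(v_1,\dots,v_N)$ be a mutation sequence starting at $\tilde B^{(0)}$ which is either a reddening sequence (in which case $\tilde B^{(0)}=[B_0\,|\,I_n]$) or a loop sequence, and let it correspond to the picture group expression $\prod_{k}x_{i_kj_k}^{\delta_k}=x_{i_Nj_N}^{\delta_N}\cdots x_{i_1j_1}^{\delta_1}$ with $\delta_k\in\{+,-\}$. Then the permutation $\rho\in S_n$ associated with this reddening or loop sequence is $$\rho\Big(\prod_k x_{i_kj_k}^{\delta_k}\Big)=\sigma\,\Big(\prod_{k}(i_k+1,\,j_k)\Big)^{-1}\sigma^{-1},$$ where $\prod_k (i_k+1,j_k)=(i_N+1,j_N)\cdots(i_1+1,j_1)$, i.e. products are taken from right to left.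
   Context: **Quiver and matrices.** Type $A_n$ with straight orientation is the quiver $1\to 2\to\cdots\to n$. Its exchange matrix $B_0$ is the $n\times n$ matrix whose $(i,j)$ entry is the number of arrows $i\to j$ minus the number of arrows $j\to i$; so $(B_0)_{i,i+1}=1$, $(B_0)_{i+1,i}=-1$, and all other entries are $0$. The framed quiver $\hat Q$ adds to $Q$ a frozen vertex $i'$ and an arrow $i\to i'$ for each $i$; the coframed quiver $\breve Q$ instead adds arrows $i'\to i$. A quiver with non-frozen vertices $1,\dots,n$ and frozen vertices $1',\dots,n'$ (an ice quiver) is encoded by its $n\times 2n$ extended exchange matrix $\tilde B=[B\,|\,C]$, with entries (arrows $i\to j$) minus (arrows $j\to i$), where $i'$ is counted as column $n+i$. Thus $\hat Q$ is $[B_0\,|\,I_n]$ and $\breve Q$ is $[B_0\,|\,-I_n]$. The right half $C$ is the $c$-matrix and its rows $c_1,\dots,c_n$ are the $c$-vectors. **Mutation.** For $1\le k\le n$, $\mu_k(\tilde B)=\tilde B'$ where $b'_{ij}=-b_{ij}$ if $i=k$ or $j=k$, and otherwise $b'_{ij}=b_{ij}+b_{ik}|b_{kj}|$ if $b_{ik}$ and $b_{kj}$ have the same sign (both positive or both negative), and $b'_{ij}=b_{ij}$ if not. Only non-frozen vertices are mutated. ''Reachable'' means obtained from $[B_0\,|\,I_n]$ by a finite sequence of mutations and permutations of the non-frozen vertices. A mutation sequence $(v_1,\dots,v_N)$ starting at $\tilde B^{(0)}$ produces $\tilde B^{(k)}=\mu_{v_k}(\tilde B^{(k-1)})$. **Roots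 and picture group notation.** For $0\le i<j\le n$ put $\beta_{ij}=e_{i+1}+e_{i+2}+\cdots+e_j\in\mathbb Z^n$. These are the positive roots of $A_n$. Every $c$-vector of every reachable matrix is of the form $\pm\beta_{ij}$ (known). The picture group $G(A_n)$ has generators $x_{ij}$ ($0\le i<j\le n$). The letter $x_{ij}$ is allowed to act on $\tilde B=[B|C]$ if some row $c_k$ of $C$ equals $\beta_{ij}$, and then it acts as $\mu_k$; the letter $x_{ij}^{-1}$ is allowed to act if some row $c_k$ of $C$ equals $-\beta_{ij}$, and then it acts as $\mu_k$. The mutation sequence $(v_1,\dots,v_N)$ corresponds to the expression $x_{i_Nj_N}^{\delta_N}\cdots x_{i_1j_1}^{\delta_1}$ (first mutation rightmost), where for each $k$ the $v_k$-th $c$-vector of $\tilde B^{(k-1)}$ is $\delta_k\beta_{i_kj_k}$ ($x^{+}=x$, $x^{-}=x^{-1}$). **Permutations.** For $\sigma\in S_n$ and a matrix $M$ with rows $M_1,\dots,M_n$, $\sigma(M)$ is the matrix with rows $M_{\sigma^{-1}(1)},\dots,M_{\sigma^{-1}(n)}$. On an extended exchange matrix $[B|C]$, $\sigma$ acts by relabelling the non-frozen vertices: $\sigma([B|C])=[B'|\sigma(C)]$ with $B'_{ij}=B_{\sigma^{-1}(i),\sigma^{-1}(j)}$. The symbol $(a,b)$ denotes the transposition of $a$ and $b$, and is the identity when $a=b$. Permutations are composed from right to left. **Reddening and loop sequences and their permutations.** A non-frozen vertex is green if there is no arrow from a frozen vertex to it (i.e. its row in $C$ has no negative entry). A reddening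 sequence is a mutation sequence starting at the framed quiver $\hat Q=[B_0|I_n]$ whose final quiver has no green vertices. Its associated permutation is the $\rho\in S_n$ with $\mu_{v_N}\cdots\mu_{v_1}(\hat Q)=\rho(\breve Q)$ (existence of $\rho$ is known). A loop sequence starting at $\tilde B^{(0)}$ is a mutation sequence with $\mu_{v_N}\cdots\mu_{v_1}(\tilde B^{(0)})=\rho(\tilde B^{(0)})$ for some $\rho\in S_n$; this $\rho$ is its associated permutation. **Standard matrices and the associated permutation of a $c$-matrix.** A matrix $M\in M_n(\mathbb Z)$ is standard if: (1) all diagonal entries are nonzero; (2) all positive entries lie on or above the diagonal and all negative entries lie on or below the diagonal; (3) every row is of the form $\pm\beta_{ij}$ with $0\le i<j\le n$. If $C=\sigma(M)$ with $M$ standard, then $\sigma$ is called the associated permutation of $C$ (it is unique). For $C=I_n$, $\sigma$ is the identity. *)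

(* Defs.v *)
From HB Require Import structures.
From mathcomp Require Import all_boot all_order all_algebra all_fingroup.

Set Implicit Arguments.
Unset Strict Implicit.
Unset Printing Implicit Defensive.

Import Order.TTheory GRing.Theory Num.Theory.
Local Open Scope ring_scope.

(* Vertices 1, ..., n are the ordinals 0, ..., n-1 of 'I_n, and the frozen
   vertex attached to i : 'I_n is column rshift n i of the extended matrix. *)
Notation extmx n := 'M[int]_(n, n + n).

Definition exchange_part n (Bt : extmx n) : 'M[int]_n := lsubmx Bt.
Definition cmatrix n (Bt : extmx n) : 'M[int]_n := rsubmx Bt.
Definition cvector n (Bt : extmx n) (k : 'I_n) : 'rV[int]_n := row k (cmatrix Bt).

Definition B0 n : 'M[int]_n :=
  \matrix_(i, j) (if j == i.+1 :> nat then 1 else if i == j.+1 :> nat then -1 else 0).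

Definition framed n : extmx n := row_mx (B0 n) 1%:M.
Definition coframed n : extmx n := row_mx (B0 n) (- 1%:M).

Definition same_sign (a b : int) : bool :=
  ((0 < a) && (0 < b)) || ((a < 0) && (b < 0)).

Definition mutate n (k : 'I_n) (Bt : extmx n) : extmx n :=
  \matrix_(i, j)
    if (i == k) || (j == lshift n k) then - Bt i j
    else if same_sign (Bt i (lshift n k)) (Bt k j)
         then Bt i j + Bt i (lshift n k) * `|Bt k j|
         else Bt i j.

(* The head of the sequence is mutated first. *)
Definition mutate_seq n (Bt : extmx n) (vs : seq 'I_n) : extmx n :=
  foldl (fun X k => mutate k X) Bt vs.

(* Right-to-left composition; the group law of 'S_n in the library goes from
   left to right. *)
Definition rl_comp n (s t : 'S_n) : 'S_n := (t * s)%g.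

Lemma rl_compE n (s t : 'S_n) (x : 'I_n) : rl_comp s t x = s (t x).
Proof. exact: permM. Qed.

Definition act_rows n m (s : 'S_n) (M : 'M[int]_(n, m)) : 'M[int]_(n, m) :=
  \matrix_(i, j) M ((s^-1)%g i) j.

Definition act_ext n (s : 'S_n) (Bt : extmx n) : extmx n :=
  row_mx (\matrix_(i, j) exchange_part Bt ((s^-1)%g i) ((s^-1)%g j))
         (act_rows s (cmatrix Bt)).

Inductive reachable n : extmx n -> Prop :=
| reach_framed : reachable (framed n)
| reach_mutate (k : 'I_n) (Bt : extmx n) :
    reachable Bt -> reachable (mutate k Bt)
| reach_perm (s : 'S_n) (Bt : extmx n) :
    reachable Bt -> reachable (act_ext s Bt).

(* The index pairs 0 <= i < j <= n of the positive roots. *)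
Record posroot n := PosRoot {
  lo : nat;
  hi : nat;
  lo_lt_hi : (lo < hi)%N;
  hi_le_n : (hi <= n)%N }.

(* e_(i+1) + ... + e_j, where the 1-based e_(l+1) is the l-th coordinate here. *)
Definition beta n (r : posroot n) : 'rV[int]_n :=
  \row_(l < n) (if (lo r <= l < hi r)%N then 1 else 0).

(* A pair (r, true) is the letter x_r and (r, false) is the letter x_r^-1. *)
Definition letter n : Type := (posroot n * bool)%type.

Definition letter_vec n (x : letter n) : 'rV[int]_n :=
  if x.2 then beta x.1 else - beta x.1.

(* Expressions are listed chronologically: the sequence [:: x_1; ...; x_N]
   stands for the word x_N ... x_1. *)
Fixpoint corresponds n (Bt : extmx n) (vs : seq 'I_n) (w : seq (letter n)) : Prop :=
  match vs, w with
  | [::], [::] => True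
  | v :: vs', x :: w' =>
      cvector Bt v = letter_vec x /\ corresponds (mutate v Bt) vs' w'
  | _, _ => False
  end.

Lemma lo_ltn n (r : posroot n) : (lo r < n)%N.
Proof. exact: leq_trans (lo_lt_hi r) (hi_le_n r). Qed.

Lemma hi_pred_ltn n (r : posroot n) : ((hi r).-1 < n)%N.
Proof. by case: r => i [|j]. Qed.

(* The transposition (i+1, j) of {1, ..., n}, hence (i, j-1) on 'I_n. *)
Definition root_transp n (r : posroot n) : 'S_n :=
  tperm (Ordinal (lo_ltn r)) (Ordinal (hi_pred_ltn r)).

(* (i_N+1, j_N) ... (i_1+1, j_1), composed from right to left. *)
Fixpoint word_perm n (w : seq (letter n)) : 'S_n :=
  match w with
  | [::] => 1%g
  | x :: w' => rl_comp (word_perm w') (root_transp x.1)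
  end.

Definition green n (Bt : extmx n) (k : 'I_n) : Prop :=
  forall j : 'I_n, 0 <= cmatrix Bt k j.

Definition reddening n (vs : seq 'I_n) : Prop :=
  forall k : 'I_n, ~ green (mutate_seq (framed n) vs) k.

Definition reddening_perm n (vs : seq 'I_n) (rho : 'S_n) : Prop :=
  reddening vs /\ mutate_seq (framed n) vs = act_ext rho (coframed n).

Definition loop_perm n (Bt : extmx n) (vs : seq 'I_n) (rho : 'S_n) : Prop :=
  mutate_seq Bt vs = act_ext rho Bt.

Definition standard n (M : 'M[int]_n) : Prop :=
  [/\ forall i : 'I_n, M i i <> 0,
      forall i j : 'I_n, (0 < M i j -> (i <= j)%N) /\ (M i j < 0 -> (j <= i)%N)
    & forall i : 'I_n, exists r : posroot n, row i M = beta r \/ row i M = - beta r].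

Definition assoc_perm n (C : 'M[int]_n) (s : 'S_n) : Prop :=
  exists M : 'M[int]_n, standard M /\ C = act_rows s M.

(* Main.v *)
Require Import Defs.
From mathcomp Require Import all_boot all_order all_algebra all_fingroup.
From mathcomp Require Import zify ring.
Set Implicit Arguments.
Unset Strict Implicit.
Unset Printing Implicit Defensive.
Import Order.TTheory GRing.Theory Num.Theory.
Local Open Scope ring_scope.

(** Each c-vector +-beta_ij is recorded as an interval [i, j) with a sign.  Two
    facts about the rows of a reachable matrix are preserved by mutation:
    B is the Gram matrix of the rows of C for the skew form
    omega(e_a, e_(a+1)) = 1, and any two rows are in one of a few relative
    positions (as signed edges {i, j} they form a noncrossing tree with a sign
    condition at common endpoints).  Being pairwise, the second fact only has
    to be checked on triples of intervals.  In a standard matrix a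
    positive row beta_ij sits at position i + 1 and a negative row -beta_ij at
    position j.  Mutation at a c-vector +-beta_ij composes this position with
    the transposition (i+1, j), on every row, and the theorem follows by
    comparing the positions in the first and last matrices. *)

(** * Signed intervals, their pairing and their compatibility *)

Record sroot := SRoot { lft : nat; rgt : nat; sgn : bool }.

Definition unit_of (s : bool) : int := if s then 1 else -1.

Definition coef (x : sroot) (l : nat) : int :=
  if (lft x <= l < rgt x)%N then unit_of (sgn x) else 0.

(* [coef x (l - 1)], without the junk value of truncated subtraction at [l = 0]. *)
Definition prev_coef (x : sroot) (l : nat) : int :=
  if (lft x < l <= rgt x)%N then unit_of (sgn x) else 0.

Definition gap (x : sroot) (k : nat) : int := coef x k + prev_coef x k.

(* The form omega above, [\sum_l coef x l * (coef y (l + 1) - coef y (l - 1))]: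
   the difference is supported around the two ends of [y]. *)
Definition pairing (x y : sroot) : int :=
  unit_of (sgn y) * (gap x (lft y) - gap x (rgt y)).

(* The 0-based row of a standard matrix on which [x] sits. *)
Definition pos (x : sroot) : nat := if sgn x then lft x else (rgt x).-1.

(* Half of the pairs of c-vectors occurring in reachable matrices; crossing
   intervals are excluded. *)
Definition compat1 (x y : sroot) : bool :=
  let: SRoot a b s := x in let: SRoot c d t := y in
  [|| (b < c)%N, (a < c)%N && (d < b)%N, (b == c) && (s ==> t)
    | ((a == c) && (b < d)%N || (b == d) && (a < c)%N) && (s && ~~ t)].

Definition compat (x y : sroot) : bool := compat1 x y || compat1 y x.

Definition flip (x : sroot) : sroot := SRoot (lft x) (rgt x) (~~ sgn x).

(* The value of [x + max(0, +-omega(x, v)) v] for compatible [x] and [v],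
   the sign being that of [v]. *)
Definition shear (v x : sroot) : sroot :=
  let: SRoot a b s := v in let: SRoot c d t := x in
  if s then
    if t then (if d == a then SRoot c b true else x)
    else if (c == a) && (b < d)%N then SRoot b d false
    else if (d == b) && (a < c)%N then SRoot a c true
    else x
  else
    if t then
      if (c == a) && (d < b)%N then SRoot d b false
      else if (d == b) && (c < a)%N then SRoot c a true
      else x
    else if c == b then SRoot a d false else x.

Definition valid (x : sroot) := (lft x < rgt x)%N.

(* Innermost conditions first, so that no condition is left unreduced. *)
Ltac crush_if := repeat match goal with
  | |- context [if ?b then _ else _] =>
      lazymatch b with context [if _ then _ else _] => fail | _ => idtac end;
      case: (boolP b) => ? /=
  end.

(** * Shears and flips of compatible intervals *)

Lemma compatC x y : compat x y = compat y x.
Proof. exact: orbC. Qed.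

Lemma valid_shear v x : valid v -> valid x -> compat x v -> valid (shear v x).
Proof.
by case: v x => a b [] [c d []]; rewrite /valid /shear /compat /compat1 /=; crush_if; lia.
Qed.

Lemma pairingC x y : valid x -> valid y -> pairing x y = - pairing y x.
Proof.
case: x y => a b s [c d t]; rewrite /valid /pairing /gap /coef /prev_coef /=.
case: s; case: t; rewrite /unit_of /=; crush_if; lia.
Qed.

Definition weight (v x : sroot) : int := Num.max 0 (unit_of (sgn v) * pairing x v).

Definition sheared (v x : sroot) : bool :=
  let: SRoot a b s := v in let: SRoot c d t := x in
  if s then if t then d == a else (c == a) && (b < d)%N || (d == b) && (a < c)%N
  else if t then (c == a) && (d < b)%N || (d == b) && (c < a)%N else c == b.

(** Compatible intervals pair to 0 or a sign, the latter exactly when they share an endpoint, so a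
    shear adds [v] at most once. *)
Lemma weightE v x : valid v -> valid x -> compat x v ->
  weight v x = (if sheared v x then 1 else 0).
Proof.
case: v x => a b s [c d t]; rewrite /valid /weight /pairing /gap /coef /prev_coef.
rewrite /sheared /compat /compat1 /unit_of /=.
case: s; case: t; crush_if;
  rewrite ?(mulr0, mul0r, mul1r, mulr1, subr0, addr0); case: leP => //; lia.
Qed.

Lemma coef_shear v x l : valid v -> valid x -> compat x v ->
  coef (shear v x) l = coef x l + weight v x * coef v l.
Proof.
move=> vv vx vxv; rewrite weightE //; move: vv vx vxv.
case: v x => a b s [c d t]; rewrite /valid /shear /coef.
rewrite /sheared /compat /compat1 /unit_of /=.
case: s; case: t; crush_if;
  rewrite /= ?(mulr0, mul0r, mul1r, mulr1, subr0, addr0) //; crush_if; lia.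
Qed.

Lemma prev_coef_shear v x l : valid v -> valid x -> compat x v ->
  prev_coef (shear v x) l = prev_coef x l + weight v x * prev_coef v l.
Proof.
move=> vv vx vxv; rewrite weightE //; move: vv vx vxv.
case: v x => a b s [c d t]; rewrite /valid /shear /prev_coef.
rewrite /sheared /compat /compat1 /unit_of /=.
case: s; case: t; crush_if;
  rewrite /= ?(mulr0, mul0r, mul1r, mulr1, subr0, addr0) //; crush_if; lia.
Qed.

Definition swap (a b k : nat) : nat := if k == a then b else if k == b then a else k.

Lemma pos_flip v : pos (flip v) = swap (lft v) (rgt v).-1 (pos v).
Proof. by case: v => a b []; rewrite /pos /swap /=; crush_if; lia. Qed.

(** A shear keeps the end that determines [pos] unless it reverses the sign of [x]. In that case [x]
    and [v] have opposite signs and share that end, and [pos] passes from one swapped value to the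
    other. Compatibility keeps every other [x] off both values. *)
Lemma pos_shear v x : valid v -> valid x -> compat x v ->
  pos (shear v x) = swap (lft v) (rgt v).-1 (pos x).
Proof.
case: v x => a b s [c d t]; rewrite /valid /shear /pos /swap /compat /compat1 /=.
case: s; case: t; crush_if; lia.
Qed.

Lemma compat_shear1 v x : valid v -> valid x -> compat x v -> compat (shear v x) (flip v).
Proof.
by case: v x => a b [] [c d []]; rewrite /valid /shear /compat /compat1 /=; crush_if; lia.
Qed.

(** Once the signs are fixed, this is linear arithmetic on six endpoints. *)
Lemma compat_shear v x y : valid v -> valid x -> valid y ->
  compat x v -> compat y v -> compat x y -> compat (shear v x) (shear v y).
Proof.
case: v x y => a b s [c d t] [e f u]; rewrite /valid /shear /compat /compat1 /=.
by case: s; case: t; case: u; crush_if; lia.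
Qed.

(** * The mutation rules for B and C in terms of intervals *)

Lemma coef_flip x l : coef (flip x) l = - coef x l.
Proof. by rewrite /coef /flip /unit_of /=; case: (sgn x); case: ifP. Qed.

Lemma prev_coef_flip x l : prev_coef (flip x) l = - prev_coef x l.
Proof. by rewrite /prev_coef /flip /unit_of /=; case: (sgn x); case: ifP. Qed.

Lemma gap_flip x k : gap (flip x) k = - gap x k.
Proof. by rewrite /gap coef_flip prev_coef_flip opprD. Qed.

Lemma pairing_flipl x y : pairing (flip x) y = - pairing x y.
Proof. rewrite /pairing !gap_flip; ring. Qed.

Lemma pairing_shearl v x y : valid v -> valid x -> compat x v ->
  pairing (shear v x) y = pairing x y + weight v x * pairing v y.
Proof.
move=> vv vx vxv; rewrite /pairing /gap !coef_shear // !prev_coef_shear //.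
move: (weight v x) => w; ring.
Qed.

Lemma pairing_self x : valid x -> pairing x x = 0.
Proof. by move=> vx; have := pairingC vx vx; lia. Qed.

Lemma pairing_shear_self v x : valid v -> valid x -> compat x v ->
  pairing (shear v x) v = pairing x v.
Proof. by move=> vv vx vxv; rewrite pairing_shearl // pairing_self // mulr0 addr0. Qed.

(** Let p = omega(x, v) and q = omega(v, y). For positive [v], bilinearity adds max(0, p) q + max(0,
    -q) p to omega(x, y), which is p|q| if p and q have the same sign and 0 otherwise; negative [v]
    is analogous. Linearity in the second argument comes from antisymmetry. *)
Lemma pairing_shear v x y : valid v -> valid x -> valid y ->
  compat x v -> compat y v ->
  pairing (shear v x) (shear v y) =
    if same_sign (pairing x v) (pairing v y)
    then pairing x y + pairing x v * `|pairing v y| else pairing x y.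
Proof.
move=> vv vx vy cx cy.
have vy' : valid (shear v y) by exact: valid_shear.
rewrite pairing_shearl // (pairingC vx vy') (pairingC vv vy').
rewrite pairing_shear_self // (pairing_shearl x) // -/(weight _ _).
rewrite (pairingC vy vx) (pairingC vy vv) (pairingC vv vx) /weight (pairingC vy vv).
move: (pairing x y) (pairing x v) (pairing v y) => r p q.
rewrite /same_sign /unit_of.
by case: (sgn v); case: (ltrgtP 0 p) => hp; case: (ltrgtP 0 q) => hq; rewrite /=;
  do 2 case: leP => ?; nia.
Qed.

(** All nonzero coordinates of [v] have the sign of [v], so the sign tests made column by column
    agree with the single [weight]. *)
Lemma coef_shear_same_sign v x l : valid v -> valid x -> compat x v ->
  coef (shear v x) l =
    if same_sign (pairing x v) (coef v l)
    then coef x l + pairing x v * `|coef v l| else coef x l.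
Proof.
move=> vv vx vxv; rewrite coef_shear // /weight /same_sign.
have : coef v l = 0 \/ coef v l = unit_of (sgn v) by rewrite /coef; case: ifP; auto.
move: (pairing x v) (coef x l) (coef v l) => p q r.
by rewrite /unit_of; case: (sgn v) => -[] ->; case: (ltrgtP 0 p) => hp; rewrite /=;
  case: leP => ?; nia.
Qed.

Lemma rgt_shear v x n : valid v -> valid x -> (rgt v <= n)%N -> (rgt x <= n)%N ->
  (rgt (shear v x) <= n)%N.
Proof. by case: v x => a b [] [c d []]; rewrite /valid /=; crush_if; lia. Qed.

Lemma coef_inj n x y : valid x -> valid y -> (rgt x <= n)%N -> (rgt y <= n)%N ->
  (forall l : 'I_n, coef x l = coef y l) -> x = y.
Proof.
case: x y => a b s [c d t]; rewrite /valid /= => vx vy hx hy e.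
have e' l : (l < n)%N -> coef (SRoot a b s) l = coef (SRoot c d t) l.
  by move=> hl; exact: (e (Ordinal hl)).
suff [-> -> ->] : [/\ a = c, b = d & s = t] by [].
(* The first and last cells of both intervals are probed; the bounds by [n] make them legal
   columns. *)
have ha : coef (SRoot a b s) a = coef (SRoot c d t) a by apply: e'; lia.
have hb : coef (SRoot a b s) b.-1 = coef (SRoot c d t) b.-1 by apply: e'; lia.
have hc : coef (SRoot a b s) c = coef (SRoot c d t) c by apply: e'; lia.
have hd : coef (SRoot a b s) d.-1 = coef (SRoot c d t) d.-1 by apply: e'; lia.
move: ha hb hc hd; rewrite /coef /=.
have -> : (a <= a < b)%N by lia.
have -> : (c <= c < d)%N by lia.
have -> : (a <= b.-1 < b)%N by lia.
have -> : (c <= d.-1 < d)%N by lia.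
by case: s {e e'}; case: t; rewrite /unit_of;
  do 4 case: ifP => //; move=> *; split=> //; lia.
Qed.

(** * Reachable matrices encoded by intervals *)

Definition encodes n (Bt : extmx n) (F : 'I_n -> sroot) : Prop :=
  [/\ forall i, valid (F i) /\ (rgt (F i) <= n)%N,
      forall i j, i != j -> compat (F i) (F j),
      forall i j, Bt i (lshift n j) = pairing (F i) (F j)
    & forall i j : 'I_n, Bt i (rshift n j) = coef (F i) j].

Definition mutate_roots n (v : 'I_n) (F : 'I_n -> sroot) (k : 'I_n) : sroot :=
  if k == v then flip (F v) else shear (F v) (F k).

Lemma encodes_mutate n (Bt : extmx n) F (v : 'I_n) :
  encodes Bt F -> encodes (mutate v Bt) (mutate_roots v F).
Proof.
move=> [vF cF bF rF]; split=> [i|i j ij|i j|i j]; rewrite /mutate_roots.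
- case: eqP => [_|/eqP iv]; first exact: vF.
  have [? ?] := vF i; have [? ?] := vF v.
  by split; [apply: valid_shear => //; exact: cF | exact: rgt_shear].
- have [vi _] := vF i; have [vj _] := vF j; have [vv _] := vF v.
  case: (eqVneq i v) ij => [->|iv] ij; case: (eqVneq j v) ij => [_|jv] // ij.
  + by rewrite compatC; apply: compat_shear1 => //; exact: cF.
  + by apply: compat_shear1 => //; exact: cF.
  + by apply: compat_shear => //; exact: cF.
- have [vi _] := vF i; have [vj _] := vF j; have [vv _] := vF v.
  rewrite mxE eq_lshift !bF.
  case: (eqVneq i v) => [->|iv]; case: (eqVneq j v) => [->|jv] /=.
  + by rewrite !pairing_self ?oppr0.
  (* The shear by [F v] preserves the pairing with [F v], as omega(v, v) = 0, so only the flip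
     changes this entry. *)
  + have vs : valid (shear (F v) (F j)) by apply: valid_shear => //; exact: cF.
    by rewrite pairing_flipl (pairingC vv vs) pairing_shear_self ?cF //
            [in LHS](pairingC vv vj).
  + have vs : valid (shear (F v) (F i)) by apply: valid_shear => //; exact: cF.
    have vf : valid (flip (F v)) by [].
    by rewrite (pairingC vs vf) pairing_flipl opprK (pairingC vv vs)
            pairing_shear_self ?cF.
  + by rewrite pairing_shear ?cF.
- have [vi _] := vF i; have [vv _] := vF v.
  rewrite mxE eq_rlshift orbF !rF bF.
  case: eqP => [->|/eqP iv]; first by rewrite coef_flip.
  by rewrite coef_shear_same_sign ?cF.
Qed.

Lemma encodes_act_ext n (Bt : extmx n) F (s : 'S_n) :
  encodes Bt F -> encodes (act_ext s Bt) (fun i => F ((s^-1)%g i)).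
Proof.
move=> [vF cF bF rF]; split=> [i|i j ij|i j|i j] //.
- by apply: cF; rewrite (inj_eq perm_inj).
- by rewrite row_mxEl mxE mxE bF.
- by rewrite row_mxEr mxE mxE rF.
Qed.

Definition simple_root (s : bool) (i : nat) : sroot := SRoot i i.+1 s.

Lemma encodes_framed n : encodes (framed n) (fun i => simple_root true i).
Proof.
split=> [i|i j ij|i j|i j].
- by split; [exact: ltnSn | exact: ltn_ord].
- by move: ij; rewrite -val_eqE /compat /compat1 /=; lia.
- rewrite row_mxEl mxE /pairing /gap /coef /prev_coef /unit_of /=.
  by crush_if; lia.
- rewrite row_mxEr mxE -val_eqE /coef /unit_of /=.
  by crush_if; lia.
Qed.

Lemma reachable_encodes n (Bt : extmx n) : reachable Bt -> exists F, encodes Bt F.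
Proof.
elim=> [|k {}Bt _ [F eF]|s {}Bt _ [F eF]].
- by exists (fun i => simple_root true i); exact: encodes_framed.
- by exists (mutate_roots k F); exact: encodes_mutate.
- by exists (fun i => F ((s^-1)%g i)); exact: encodes_act_ext.
Qed.

(** * Positions along a mutation sequence *)

Definition root_of_letter n (x : letter n) : sroot := SRoot (lo x.1) (hi x.1) x.2.

Lemma letter_vecE n (x : letter n) (l : 'I_n) :
  letter_vec x 0 l = coef (root_of_letter x) l.
Proof.
by case: x => r []; rewrite /letter_vec /coef /root_of_letter !mxE //=; case: ifP.
Qed.

Lemma encodes_cvector n (Bt : extmx n) F (v : 'I_n) (x : letter n) :
  encodes Bt F -> cvector Bt v = letter_vec x -> F v = root_of_letter x.
Proof.
move=> [vF _ _ rF] e; have [vv hv] := vF v.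
apply: (@coef_inj n) => //; [exact: lo_lt_hi | exact: hi_le_n | move=> l].
by rewrite -letter_vecE -e !mxE rF.
Qed.

Lemma root_transpE n (r : posroot n) (i : 'I_n) :
  root_transp r i = swap (lo r) (hi r).-1 i :> nat.
Proof.
by rewrite /root_transp /tperm permE /= -!val_eqE /swap;
  case: ifP => // _; case: ifP.
Qed.

Lemma pos_mutate_roots n (Bt : extmx n) F (v k : 'I_n) : encodes Bt F ->
  pos (mutate_roots v F k) = swap (lft (F v)) (rgt (F v)).-1 (pos (F k)).
Proof.
move=> [vF cF _ _]; rewrite /mutate_roots; case: eqP => [->|/eqP kv].
  exact: pos_flip.
by have [? _] := vF v; have [? _] := vF k; rewrite pos_shear ?cF.
Qed.

(** The ordinal [i] carries the bound on [pos (F k)] needed to apply [word_perm]. As [w] is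
    chronological, the transposition of its head acts first. *)
Lemma pos_mutate_seq n (vs : seq 'I_n) (w : seq (letter n)) (Bt : extmx n) F :
  encodes Bt F -> corresponds Bt vs w ->
  exists2 G, encodes (mutate_seq Bt vs) G &
    forall k i : 'I_n, pos (F k) = i -> pos (G k) = word_perm w i.
Proof.
elim: vs w Bt F => [|v vs IH] [|x w] Bt F eF //=.
  by exists F => // k i; rewrite perm1.
move=> [ex cw]; have [G eG pG] := IH _ _ _ (encodes_mutate v eF) cw.
exists G => // k i pk; rewrite rl_compE; apply: pG.
by rewrite (pos_mutate_roots _ _ eF) pk (encodes_cvector eF ex) root_transpE.
Qed.

(** Row [s i] of C is row [i] of M, an interval containing [i] because the diagonal is nonzero. If
    positive, its first entry lies on or above the diagonal, so it starts at [i]; if negative, its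
    last entry lies on or below, so it ends at [i]. *)
Lemma pos_assoc_perm n (Bt : extmx n) F (s : 'S_n) :
  encodes Bt F -> assoc_perm (cmatrix Bt) s -> forall i, pos (F (s i)) = i.
Proof.
move=> [vF _ _ rF] [M [[M0 M1 _] eM]] i; have [] := vF (s i).
have Mc j : M i j = coef (F (s i)) j.
  by rewrite -rF; have /matrixP/(_ (s i) j) := eM; rewrite !mxE permK.
have := M0 i; rewrite Mc; case: (F (s i)) Mc => a b t; rewrite /valid /coef /pos /=.
move=> Mc; case: ifP => // /andP[ai ib] _ ab bn.
case: t Mc => Mc /=.
  have an : (a < n)%N by lia.
  have [+ _] := M1 i (Ordinal an); rewrite Mc /= leqnn ab /= => /(_ isT); lia.
have bn' : (b.-1 < n)%N by lia.
have [_ +] := M1 i (Ordinal bn'); rewrite Mc /=.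
have -> : (a <= b.-1 < b)%N by lia.
by move=> /(_ isT); lia.
Qed.

Theorem theorem2p3 (n : nat) (hn : (1 <= n)%N)
    (Bt : extmx n) (hBt : reachable Bt)
    (sigma : 'S_n) (hsigma : assoc_perm (cmatrix Bt) sigma)
    (vs : seq 'I_n) (w : seq (letter n)) (hw : corresponds Bt vs w)
    (rho : 'S_n)
    (hrho : (Bt = framed n /\ reddening_perm vs rho) \/ loop_perm Bt vs rho) :
  rho = rl_comp (rl_comp sigma (word_perm w)^-1%g) (sigma^-1)%g.
Proof.
have [F eF] := reachable_encodes hBt.
have pF := pos_assoc_perm eF hsigma.
have [G eG pG] := pos_mutate_seq eF hw.
(* In a loop the two rows coincide. After reddening they are opposite simple roots, and an interval
   of length one has the same position for either sign. *)
have GF k : pos (G (rho k)) = pos (F k).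
  have [vG _ _ rG] := eG; have [vF _ _ rF] := eF.
  have [vGk nGk] := vG (rho k); have [vFk nFk] := vF k.
  case: hrho => [[eB [_ eR]]|eL].
    have -> : G (rho k) = simple_root false k.
      apply: (@coef_inj n) => //; [exact: ltnSn | exact: (ltn_ord k) | move=> l].
      rewrite -rG eB eR row_mxEr mxE mxE permK row_mxEr !mxE -val_eqE /coef /unit_of /=.
      by crush_if; lia.
    have -> // : F k = simple_root true k.
    apply: (@coef_inj n) => //; [exact: ltnSn | exact: (ltn_ord k) | move=> l].
    rewrite -rF eB row_mxEr !mxE -val_eqE /coef /unit_of /=.
    by crush_if; lia.
  congr pos; apply: (@coef_inj n) => // l.
  by rewrite -rG eL row_mxEr mxE mxE permK -rF.
apply/permP => k; rewrite !rl_compE.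
set i := (sigma^-1)%g k; have -> : k = sigma i by rewrite permKV.
(* Row [rho (sigma i)] starts at position j = sigma^-1 (rho (sigma i)) and ends at [word_perm w] j,
   which by [GF] is the initial position i of row [sigma i]. *)
have /(congr1 sigma) : (sigma^-1)%g (rho (sigma i)) = ((word_perm w)^-1)%g i.
  apply: (@perm_inj _ (word_perm w)); rewrite permKV; apply: val_inj => /=.
  by rewrite -(pG (rho (sigma i))) ?GF ?pF // -[in LHS](permKV sigma (rho _)) pF.
by rewrite permKV.
Qed.
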